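(* Let $\mathcal{H}$ be a complex Hilbert space, let $k \ge 0$ be an integer, and let $\widetilde{P}, \widetilde{Q}$ be (orthogonal) projections on $\mathcal{H}$ such that $\widetilde{P} - \widetilde{Q} \in \mathcal{B}_{2k+1}$, the Schatten ideal of exponent $2k+1$ on $\mathcal{H}$. Then the operator $\widetilde{Q}\widetilde{P} : \widetilde{P}\mathcal{H} \to \widetilde{Q}\mathcal{H}$ is Fredholm, with $$\operatorname{Index}(\widetilde{Q}\widetilde{P}) = \operatorname{tr}\big((\widetilde{P} - \widetilde{Q})^{2k+1}\big).$$
   Context: A projection on $\mathcal{H}$ is a bounded operator $P$ with $P = P^* = P^2$. For $p \ge 1$, the Schatten ideal $\mathcal{B}_p$ consists of the compact operators $T$ on $\mathcal{H}$ with $\operatorname{tr}(|T|^p) < \infty$. The operator $\widetilde{Q}\widetilde{P} : \widetilde{P}\mathcal{H} \to \widetilde{Q}\mathcal{H}$ is the restriction of the product $\widetilde{Q}\widetilde{P}$ to the closed subspace $\widetilde{P}\mathcal{H}$ (the range of $\widetilde{P}$), regarded as a bounded operator into the closed subspace $\widetilde{Q}\mathcal{H}$ (the range of $\widetilde{Q}$). A bounded operator $T$ between Hilbert spaces is Fredholm if it has closed range and finite-dimensional kernel and cokernel, and then $\operatorname{Index}(T) = \dim\ker T - \dim\operatorname{coker} T$. $\operatorname{tr}$ is the usual operator trace on trace class operators on $\mathcal{H}$. *)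

(* Defs.v *)
From HB Require Import structures.
From mathcomp Require Import all_boot all_order all_algebra.
From mathcomp Require Import sesquilinear finmap complex.
From mathcomp Require Import all_classical all_reals all_analysis.
From mathcomp Require Import summability.
Import Order.TTheory GRing.Theory Num.Theory.
Import numFieldNormedType.Exports.

Set Implicit Arguments.
Unset Strict Implicit.
Unset Printing Implicit Defensive.

Local Open Scope classical_set_scope.
Local Open Scope ring_scope.
Local Open Scope complex_scope.

(* Sesquilinear forms are linear in the first variable.  The norm of a
   [normedModType R[i]] takes its values in the (real) elements of [R[i]],
   hence the absence of a cast in [inner_norm]. *)
HB.mixin Record NormedModule_isHilbert (R : realType) H
    & CompleteNormedModule R[i] H := {
  inner : {dot H for (@Num.conj R[i])} ;
  inner_norm : forall x : H, inner x x = `|x| ^+ 2 }.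

#[short(type="hilbertType")]
HB.structure Definition Hilbert (R : realType) :=
  {H of CompleteNormedModule R[i] H & NormedModule_isHilbert R H}.

Notation "<| x , y |>" := (inner x y)
  (at level 0, x at level 69, y at level 69) : ring_scope.

Definition bounded_op (R : realType) (H1 H2 : hilbertType R) (T : H1 -> H2) :=
  exists M : R[i], forall x, `|T x| <= M * `|x|.

Definition is_adjoint (R : realType) (H1 H2 : hilbertType R)
    (T : H1 -> H2) (T' : H2 -> H1) :=
  forall x y, <| T x, y |> = <| x, T' y |>.

HB.mixin Record isProjection (R : realType) (H : hilbertType R) (P : H -> H) := {
  proj_bounded : bounded_op P ;
  proj_selfadjoint : is_adjoint P P ;
  proj_idem : forall x, P (P x) = P x }.

#[short(type="projection")]
HB.structure Definition Projection (R : realType) (H : hilbertType R) :=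
  {P of @GRing.Linear R[i] H H *:%R P & isProjection R H P}.

(* The closed subspace [P H] of [H], as a Hilbert space with the norm and the
   inner product of [H]. *)
Section ProjectionRange.
Variables (R : realType) (H : hilbertType R) (P : projection H).

Definition prange_pred : {pred H} := mem (range P).

Record prange := PRange { prange_val : H ; _ : prange_val \in prange_pred }.

HB.instance Definition _ := [isSub for prange_val].
HB.instance Definition _ := [Choice of prange by <:].

Lemma prange_submod : submod_closed prange_pred.
Proof.
split=> [|a x y]; first by rewrite inE/=; exists 0 => //; rewrite linear0.
rewrite !inE => -[u _ <-] [v _ <-]; exists (a *: u + v) => //.
by rewrite linearP.
Qed.

HB.instance Definition _ :=
  GRing.isSubmodClosed.Build R[i] H prange_pred prange_submod.
HB.instance Definition _ := [SubChoice_isSubLmodule of prange by <:].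

Let prange_norm (x : prange) : R[i] := `|val x|.

Let prange_normD x y : prange_norm (x + y) <= prange_norm x + prange_norm y.
Proof. by rewrite /prange_norm raddfD ler_normD. Qed.

Let prange_normZ l x : prange_norm (l *: x) = `|l| * prange_norm x.
Proof. by rewrite /prange_norm linearZ normrZ. Qed.

Let prange_norm0_eq0 x : prange_norm x = 0 -> x = 0.
Proof. by move/normr0_eq0 => x0; apply: val_inj; rewrite x0 raddf0. Qed.

HB.instance Definition _ := @Lmodule_isNormed.Build R[i] prange
  prange_norm prange_normD prange_normZ prange_norm0_eq0.

Lemma proj_continuous : continuous P.
Proof.
apply/linear_bounded_continuous/linear_boundedP.
have [M PM] := proj_bounded (s := P).
near=> r => x; apply: le_trans (_ : `|M| * `|x| <= _).
  have Mx0 : 0 <= M * `|x| by apply: le_trans (PM x).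
  by rewrite (le_trans (PM x))// -{1}(ger0_norm Mx0) normrM normr_id.
apply: ler_wpM2r => //; near: r; exact: nbhs_pinfty_ge.
Unshelve. all: by end_near. Qed.

Let prange_complete (F : set_system prange) :
  ProperFilter F -> cauchy F -> cvg F.
Proof.
move=> FF /cauchy_ballP Fc.
have /cauchy_cvg vFy : cauchy (prange_val @ F).
  apply/cauchy_ballP => e e0; have := Fc e e0.
  case=> -[A B] /= [FA FB] AB.
  exists (prange_val @` A, prange_val @` B) => /=.
    by split; [apply: filterS FA|apply: filterS FB] => x ?; exists x.
  move=> -[_ _] /= [[a Aa <-] [b Bb <-]].
  by have := AB (a, b) (conj Aa Bb); rewrite -!ball_normE.
have {vFy}/cvg_ex[y Fy] := vFy _.
have Py : P y = y.
  have Pv : P \o prange_val @ F --> P y.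
    by apply: cvg_comp Fy _; exact: proj_continuous.
  have PvE : P \o prange_val = prange_val.
    apply/funext => -[x /= /[dup] + _]; rewrite inE => -[z _ <-].
    exact: proj_idem.
  by rewrite PvE in Pv; exact: (cvg_unique _ Pv Fy).
have yP : y \in prange_pred by rewrite inE -Py; exists y.
apply/cvg_ex; exists (PRange yP); apply/cvg_ballP => e e0.
have /cvg_ballP/(_ e e0) := Fy.
by apply: filterS => x; rewrite -!ball_normE.
Qed.

HB.instance Definition _ := Uniform_isComplete.Build prange prange_complete.

Let prange_inner (x y : prange) : R[i] := <| val x, val y |>.

Let prange_inner_bilinear : bilinear_for
  ( *%R : GRing.Scale.law R[i] R[i])
  (@Num.conj R[i] \; *%R : GRing.Scale.law R[i] R[i]) prange_inner.
Proof.
split=> [y a x x'|x a y y']; rewrite /prange_inner.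
  by rewrite [val (_ + _)]linearP linearPl.
by rewrite [val (_ + _)]linearP linearPr.
Qed.

HB.instance Definition _ := @bilinear_isBilinear.Build R[i] prange prange R[i]
  _ _ prange_inner prange_inner_bilinear.

Let prange_inner_herm x y :
  prange_inner x y = (-1) ^+ false * Num.conj (prange_inner y x).
Proof. exact: hermitian_subproof. Qed.

HB.instance Definition _ := @isHermitianSesquilinear.Build R[i] prange
  false (@Num.conj R[i]) prange_inner prange_inner_herm.

Let prange_inner_gt0 x : x != 0 -> 0 < prange_inner x x.
Proof.
by move=> x0; apply: neq0_dnorm_gt0; apply: contraNN x0 => /eqP x0;
  apply/eqP/val_inj; rewrite x0 raddf0.
Qed.

HB.instance Definition _ := @isDotProduct.Build R[i] prange
  prange_inner prange_inner_gt0.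

Let prange_inner_norm (x : prange) : prange_inner x x = `|x| ^+ 2.
Proof. exact: inner_norm. Qed.

HB.instance Definition _ :=
  @NormedModule_isHilbert.Build R prange prange_inner prange_inner_norm.

End ProjectionRange.

Section Compression.
Variables (R : realType) (H : hilbertType R) (Q P : projection H).

Lemma compression_subproof (x : prange P) : Q (P (val x)) \in prange_pred Q.
Proof. by rewrite inE; exists (P (val x)). Qed.

(* The operator Q P : P H -> Q H *)
Definition compression (x : prange P) : prange Q :=
  PRange (compression_subproof x).

Lemma compression_linear : linear compression.
Proof. by move=> a x y; apply: val_inj; rewrite /= !linearP. Qed.

HB.instance Definition _ := @GRing.isLinear.Build R[i] (prange P) (prange Q) _
  compression compression_linear.

End Compression.
Arguments compression {R H} Q P x.

Section Dimension.
Variables (K : fieldType) (V : lmodType K).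

(* [b] induces a basis of the quotient [A / B] of a subspace [A] of [V] by a
   subspace [B] of [A]; for [B = [set 0]] it is a basis of [A]. *)
Definition quotient_basis (A B : set V) n (b : 'I_n -> V) :=
  (forall i, A (b i)) /\
  forall v, A v -> exists! c : 'rV[K]_n, B (v - \sum_i c 0 i *: b i).

Definition finite_quotient_dim (A B : set V) :=
  exists n (b : 'I_n -> V), quotient_basis A B b.

(* junk value 0 when the quotient has infinite dimension *)
Definition quotient_dim (A B : set V) : nat :=
  xget 0%N [set n | exists b : 'I_n -> V, quotient_basis A B b].

End Dimension.

Section Fredholm.
Variables (R : realType) (H1 H2 : hilbertType R) (T : {linear H1 -> H2}).

Let ker : set H1 := T @^-1` [set 0].

Definition fredholm :=
  [/\ bounded_op T, closed (range T), finite_quotient_dim ker [set 0]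
    & finite_quotient_dim setT (range T)].

Definition fredholm_index : int :=
  (quotient_dim ker [set 0])%:Z - (quotient_dim setT (range T))%:Z.

End Fredholm.

(* An orthonormal basis is a maximal orthonormal family. *)
Definition orthonormal_basis (R : realType) (H : hilbertType R) (I : choiceType)
    (e : I -> H) :=
  (forall i j, <| e i, e j |> = (i == j)%:R) /\
  (forall x, (forall i, <| x, e i |> = 0) -> x = 0).

Section Operators.
Variables (R : realType) (H : hilbertType R).
Implicit Types (T S : {linear H -> H}) (p n : nat).

Definition op_pow T n : H -> H := iter n T.

Lemma op_pow_linear T n : linear (op_pow T n).
Proof.
by move=> a x y; rewrite /op_pow; elim: n => //= n ->; rewrite linearP.
Qed.

HB.instance Definition _ T n :=
  @GRing.isLinear.Build R[i] H H _ (op_pow T n) (op_pow_linear T n).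

Definition compact_op T := precompact (T @` [set x | `|x| <= 1]).

Definition positive_op S := bounded_op S /\ forall x, 0 <= <| S x, x |>.

(* S = |T|, the positive square root of T^* T *)
Definition is_modulus T S :=
  positive_op S /\
  exists2 T' : H -> H, is_adjoint T T' & forall x, S (S x) = T' (T x).

Definition finite_positive_trace S :=
  forall (I : choiceType) (e : I -> H), orthonormal_basis e ->
    (\esum_(i in [set: I]) (complex.Re <| S (e i), e i |>)%:E < +oo)%E.

Definition schatten p T :=
  compact_op T /\
  exists2 S : {linear H -> H}, is_modulus T S
    & finite_positive_trace (op_pow S p).

Definition trace_class := schatten 1.

(* The value is meaningful for trace class operators only. *)
Definition trace T : R[i] :=
  xget 0 [set t | forall (I : choiceType) (e : I -> H), orthonormal_basis e ->
    partial_sum (fun i => <| T (e i), e i |> : R[i]^o) @ totally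
      --> (t : R[i]^o)].

End Operators.

(* Hence the quantifications over all orthonormal bases in
   [finite_positive_trace] and in [trace] are not vacuous. *)
Lemma orthonormal_basis_exists (R : realType) (H : hilbertType R) :
  exists (I : choiceType) (e : I -> H), orthonormal_basis e.
Proof.
pose ortho (A : set H) := forall x y, A x -> A y -> <| x, y |> = (x == y)%:R.
have [F Fo Ft x y [A FA Ax] [B FB By]|A [Ao Amax]] := @Zorn_bigcup H ortho.
  by have [AB|BA] := Ft _ _ FA FB;
    [apply: (Fo _ FB) => //; apply: AB|apply: (Fo _ FA) => //; apply: BA].
exists (set_type A), val; split=> [i j|x xA].
  by rewrite Ao -?val_eqE//; apply: set_valP.
apply/eqP/negPn/negP => x0.
pose u := `|x|^-1 *: x.
have uA y : A y -> <| u, y |> = 0.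
  move=> Ay; have := xA (exist _ y (mem_set Ay)) => /= xy.
  by rewrite linearZl_LR/= xy mulr0.
have u1 : <| u, u |> = 1.
  rewrite inner_norm /u normrZ normfV normr_id mulVf ?expr1n//.
  by rewrite normr_eq0.
have nuA : ~ A u by move=> /uA; rewrite u1 => /eqP; rewrite oner_eq0.
have Au y : A y -> <| y, u |> = 0.
  by move=> /uA /eqP; rewrite herm_eq0C => /eqP.
apply: (Amax (A `|` [set u])).
  by split=> [|/(_ u) uAA]; [left|apply/nuA/uAA; right].
move=> y z [Ay|->] [Az|->]; first exact: Ao.
- by rewrite Au//; case: eqP => // yu; rewrite -yu in nuA.
- by rewrite uA//; case: eqP => // yu; rewrite yu in nuA.
- by rewrite u1 eqxx.
Qed.

(* Main.v *)
(* Let A = P - Q and B = 1 - P - Q.  Then A^2 + B^2 = 1 and A B = - B A.  Since A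
   is compact and self-adjoint, there is an orthonormal basis g of eigenvectors,
   A g_i = mu_i g_i with -1 <= mu_i <= 1, and the Schatten condition says that
   |mu_i|^(2k+1) is summable; hence A^(2k+1) has trace the sum of mu_i^(2k+1) in
   any orthonormal basis.  As B maps the mu-eigenspace of A to the
   (-mu)-eigenspace and is injective for mu^2 <> 1, the contributions of mu and
   - mu cancel when 0 < mu < 1, and dim ker (A - 1) - dim ker (A + 1) remains.
   Finally ker (A - 1) is the kernel of the compression, and ker (A + 1) is the
   orthogonal complement of its range in Q H: if y in Q H is orthogonal to
   ker (A + 1), then y = (1 - A^2) z for some z, and y = Q P (P Q z). *)
Require Import Defs.
From HB Require Import structures.
From mathcomp Require Import all_boot all_order all_algebra complex.
From mathcomp Require Import sesquilinear finmap ring lra.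
From mathcomp Require Import all_classical all_reals all_analysis.
From mathcomp Require Import summability.
Import Order.TTheory GRing.Theory Num.Theory.
Import numFieldNormedType.Exports.

Set Implicit Arguments.
Unset Strict Implicit.
Unset Printing Implicit Defensive.

Local Open Scope classical_set_scope.
Local Open Scope ring_scope.
Local Open Scope complex_scope.

#[local] Existing Instance totally_filter.

(** * Inner products *)

Section AbsSquare.
Variable R : realType.
Implicit Types (z w : R[i]) (r : R).

(** Norms are [R[i]]-valued; real-valued squares, here and in [sqn], put the estimates in reach of
    [lra] and avoid square roots. *)
Definition absq z : R := complex.Re z ^+ 2 + complex.Im z ^+ 2.

Lemma absqE z : (absq z)%:C = `|z| ^+ 2.
Proof. exact: add_Re2_Im2. Qed.

Lemma absq_ge0 z : 0 <= absq z.
Proof. by rewrite addr_ge0// sqr_ge0. Qed.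

Lemma absqM z w : absq (z * w) = absq z * absq w.
Proof. by case: z w => [a b] [c d]; rewrite /absq /=; ring. Qed.

Lemma absqR r : absq r%:C = r ^+ 2.
Proof. by rewrite /absq /= expr0n addr0. Qed.

Lemma absq0 : absq 0 = 0.
Proof. by rewrite /absq /= expr0n addr0. Qed.

Lemma absq_eq0 z : absq z = 0 -> z = 0.
Proof.
move/(congr1 (fun r => r%:C)); rewrite absqE => /eqP.
by rewrite sqrf_eq0 normr_eq0 => /eqP.
Qed.

Lemma absqJ z : absq (Num.conj z) = absq z.
Proof. by case: z => a b; rewrite /absq /= sqrrN. Qed.

Lemma mul_conj z : z * Num.conj z = (absq z)%:C.
Proof. by rewrite absqE normCK. Qed.

End AbsSquare.

Section InnerProduct.
Variables (R : realType) (H : hilbertType R).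
Implicit Types (x y z : H) (a : R[i]) (r : R).

Let ip : {dot H for @Num.conj R[i]} := inner.

Definition sqn x : R := complex.Re <| x, x |>.
Definition rip x y : R := complex.Re <| x, y |>.

Lemma ipC x y : <| x, y |> = Num.conj <| y, x |>.
Proof. by have := hermitian_subproof (s := inner) x y; rewrite expr0 mul1r. Qed.

Lemma ipZl a x y : <| a *: x, y |> = a * <| x, y |>.
Proof. exact: (linearZl_LR ip). Qed.

Lemma ipZr a x y : <| x, a *: y |> = Num.conj a * <| x, y |>.
Proof. exact: (linearZr_LR ip). Qed.

Lemma ipDl x y z : <| x + y, z |> = <| x, z |> + <| y, z |>.
Proof. exact: (linearDl ip). Qed.

Lemma ipDr x y z : <| z, x + y |> = <| z, x |> + <| z, y |>.
Proof. exact: (linearDr ip). Qed.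

Lemma ipNl x y : <| - x, y |> = - <| x, y |>.
Proof. exact: (linearNl ip). Qed.

Lemma ipNr x y : <| x, - y |> = - <| x, y |>.
Proof. exact: (linearNr ip). Qed.

Lemma ipBl x y z : <| x - y, z |> = <| x, z |> - <| y, z |>.
Proof. exact: (linearBl ip). Qed.

Lemma ipBr x y z : <| z, x - y |> = <| z, x |> - <| z, y |>.
Proof. exact: (linearBr ip). Qed.

Lemma ip0l x : <| 0, x |> = 0.
Proof. exact: (linear0l ip). Qed.

Lemma ip0r x : <| x, 0 |> = 0.
Proof. exact: (linear0r ip). Qed.

Lemma ip_eq0C x y : <| x, y |> = 0 -> <| y, x |> = 0.
Proof. by move=> xy; rewrite ipC xy conjC0. Qed.

Lemma ipxx x : <| x, x |> = (sqn x)%:C.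
Proof.
apply/esym/RRe_real/ger0_real; rewrite inner_norm; exact: exprn_ge0.
Qed.

Lemma norm_sqn x : `|x| ^+ 2 = (sqn x)%:C.
Proof. by rewrite -ipxx inner_norm. Qed.

Lemma sqn_ge0 x : 0 <= sqn x.
Proof. by rewrite -lecR -ipxx inner_norm; exact: exprn_ge0. Qed.

Lemma sqn_eq0 x : sqn x = 0 -> x = 0.
Proof.
move=> x0; apply/eqP; rewrite -normr_eq0 -sqrf_eq0 norm_sqn x0; exact/eqP.
Qed.

Lemma sqn0 : sqn 0 = 0.
Proof. by rewrite /sqn ip0l. Qed.

Lemma sqn_gt0 x : x != 0 -> 0 < sqn x.
Proof.
by move=> x0; rewrite lt_neqAle sqn_ge0 andbT eq_sym; apply: contra x0 => /eqP/sqn_eq0/eqP.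
Qed.

Lemma norm_ltE x r : 0 < r -> (`|x| < r%:C) = (sqn x < r ^+ 2).
Proof.
move=> r0; have r0' : 0 < r%:C :> R[i] by rewrite ltcR.
rewrite -(ltr_pXn2r (n := 2)) ?nnegrE ?normr_ge0 ?ltW//.
by rewrite norm_sqn -rmorphXn ltcR.
Qed.

Lemma norm_leE x r : 0 <= r -> (`|x| <= r%:C) = (sqn x <= r ^+ 2).
Proof.
move=> r0; have r0' : 0 <= r%:C :> R[i] by rewrite lecR.
rewrite -(ler_pXn2r (n := 2)) ?nnegrE ?normr_ge0//.
by rewrite norm_sqn -rmorphXn lecR.
Qed.

Lemma ripC x y : rip x y = rip y x.
Proof. by rewrite /rip ipC; case: <| y, x |>. Qed.

Lemma sqnD x y : sqn (x + y) = sqn x + sqn y + 2 * rip x y.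
Proof.
rewrite /sqn ipDl !ipDr !raddfD /= -/(rip x y) -/(rip y x) (ripC y x) /sqn.
ring.
Qed.

Lemma ripNr x y : rip x (- y) = - rip x y.
Proof. by rewrite /rip ipNr raddfN. Qed.

Lemma sqnN x : sqn (- x) = sqn x.
Proof. by rewrite /sqn ipNl ipNr opprK. Qed.

Lemma sqnB x y : sqn (x - y) = sqn x + sqn y - 2 * rip x y.
Proof. by rewrite sqnD sqnN ripNr mulrN. Qed.

Lemma sqnZ a x : sqn (a *: x) = absq a * sqn x.
Proof. by rewrite /sqn ipZl ipZr mulrA mul_conj ipxx -rmorphM. Qed.

Lemma sqnZr r x : sqn (r%:C *: x) = r ^+ 2 * sqn x.
Proof. by rewrite sqnZ absqR. Qed.

Lemma sqnD_le x y : sqn (x + y) <= 2 * (sqn x + sqn y).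
Proof. by have := sqn_ge0 (x - y); rewrite sqnB sqnD; lra. Qed.

Lemma sqnB_le x y : sqn (x - y) <= 2 * (sqn x + sqn y).
Proof. by have := sqn_ge0 (x + y); rewrite sqnB sqnD; lra. Qed.

Lemma bessel1 x g : sqn g = 1 -> absq <| x, g |> <= sqn x.
Proof.
move=> g1; have := sqn_ge0 (x - <| x, g |> *: g).
rewrite sqnB sqnZ g1 mulr1 /rip ipZr [_ * <| _, _ |>]mulrC mul_conj /=; lra.
Qed.

Lemma ip_sum_l (I : Type) (s : seq I) (P : pred I) (f : I -> H) y :
  <| \sum_(i <- s | P i) f i, y |> = \sum_(i <- s | P i) <| f i, y |>.
Proof. exact: (linear_sumlz ip). Qed.

Lemma ip_ext x y : (forall z, <| x, z |> = <| y, z |>) -> x = y.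
Proof.
move=> xy; apply/eqP; rewrite -subr_eq0; apply/eqP/sqn_eq0.
by rewrite /sqn ipBl xy subrr.
Qed.

Lemma complex_gt0P a : 0 < a -> exists2 r : R, 0 < r & a = r%:C.
Proof.
case: a => u v; rewrite ltcE /= => /andP[/eqP -> u0]; by exists u.
Qed.

Lemma ball_sqn x y r : 0 < r -> ball x r%:C y <-> sqn (x - y) < r ^+ 2.
Proof. by move=> r0; rewrite -ball_normE /ball_ /= norm_ltE. Qed.

Lemma sqn_nbhs x (d : R) : 0 < d -> nbhs x [set y | sqn (x - y) < d].
Proof.
move=> d0; apply/nbhs_ballP; exists (Num.sqrt d)%:C => /=.
  by rewrite ltcR sqrtr_gt0.
by move=> y /= /ball_sqn; rewrite sqrtr_gt0 sqr_sqrtr ?ltW//; apply.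
Qed.

End InnerProduct.

(* Vector identities are checked against an arbitrary vector, where [ring] applies. *)
Ltac vec := apply: ip_ext => ?; rewrite !(ipDl, ipBl, ipNl, ipZl, ip0l); ring.

(** * Unconditional sums and orthonormal expansions *)

Section UnconditionalSums.
Variables (R : realType) (I : choiceType).
Implicit Types (f g : I -> R) (l : R) (J : {fset I}).

(** Convergence along finite subsets, as for [totally]; unlike [\esum], it admits signed families
    and hence differences. *)
Definition hsum f l := forall d, 0 < d -> exists J0,
  forall J, (J0 `<=` J)%fset -> `|\sum_(i <- J) f i - l| < d.

Lemma eq_hsum f g l : f =1 g -> hsum f l -> hsum g l.
Proof. by move=> /funext ->. Qed.

Lemma hsum_lin f g l m a b : hsum f l -> hsum g m ->
  hsum (fun i => a * f i + b * g i) (a * l + b * m).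
Proof.
move=> fl gm d d0; pose c := 1 + `|a| + `|b|.
have c0 : 0 < c by rewrite /c -addrA ltr_pwDl// addr_ge0.
have dc0 : 0 < d / c by rewrite divr_gt0.
have [J1 fJ] := fl _ dc0; have [J2 gJ] := gm _ dc0.
exists (J1 `|` J2)%fset => J; rewrite fsubUset => /andP[/fJ + /gJ].
set s := (X in `|X - l|); set t := (X in `|X - m|) => sl tm.
rewrite big_split/= -!mulr_sumr -/s -/t.
have -> : a * s + b * t - (a * l + b * m) = a * (s - l) + b * (t - m) by ring.
apply: le_lt_trans (ler_normD _ _) _; rewrite !normrM.
have -> : d = d / c + `|a| * (d / c) + `|b| * (d / c).
  by rewrite /c; field; rewrite gt_eqF.
apply: ltr_leD; first apply: (@le_lt_trans _ _ (`|a| * (d / c))).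
- by rewrite ler_wpM2l// ltW.
- by rewrite ltrDr.
- by rewrite ler_wpM2l// ltW.
Qed.

Lemma hsumB f g l m : hsum f l -> hsum g m -> hsum (fun i => f i - g i) (l - m).
Proof.
move=> fl gm; have := hsum_lin 1 (-1) fl gm; rewrite mul1r mulN1r.
by apply: eq_hsum => i; rewrite mul1r mulN1r.
Qed.

Lemma hsumZ a f l : hsum f l -> hsum (fun i => a * f i) (a * l).
Proof.
move=> fl; have := hsum_lin a 0 fl fl; rewrite mul0r addr0.
by apply: eq_hsum => i; rewrite mul0r addr0.
Qed.

Lemma hsum_uniq f l m : hsum f l -> hsum f m -> l = m.
Proof.
move=> fl fm; apply/eqP; rewrite -subr_eq0 -normr_eq0 eq_le normr_ge0 andbT.
apply/ler_addgt0Pr => d d0; rewrite add0r.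
have d20 : 0 < d / 2 by rewrite divr_gt0.
have [J1 h1] := fl _ d20; have [J2 h2] := fm _ d20.
have := h1 (J1 `|` J2)%fset (fsubsetUl _ _).
have := h2 (J1 `|` J2)%fset (fsubsetUr _ _).
set s := \sum_(i <- _) _ => a1 a2.
have -> : l - m = (s - m) - (s - l) by ring.
apply: le_trans (ler_normB _ _) _; lra.
Qed.

Lemma sum_fset_le f J J' : (forall i, 0 <= f i) -> (J `<=` J')%fset ->
  \sum_(i <- J) f i <= \sum_(i <- J') f i.
Proof.
move=> f0 JJ'; rewrite [leRHS](big_fsetID _ (mem J)) /=.
have -> : [fset x in J' | x \in J]%fset = J.
  by apply/fsetP => x; rewrite !inE /= andbC; case: (boolP (x \in J)) => // /(fsubsetP JJ').
by rewrite lerDl sumr_ge0.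
Qed.

Lemma esum_fsetE f :
  \esum_(i in [set: I]) (f i)%:E =
  ereal_sup [set (\sum_(i <- J) f i)%:E | J in [set: {fset I}]].
Proof.
rewrite /esum; congr ereal_sup; apply/seteqP; split => [_ [A [finA _] <-]|_ [J _ <-]].
  by exists (fset_set A) => //; rewrite fsbig_finite//= sumEFin.
exists [set` J]; first by split.
by rewrite fsbig_finite//= set_fsetK sumEFin.
Qed.

Lemma esum_hsum f l : (forall i, 0 <= f i) ->
  \esum_(i in [set: I]) (f i)%:E = l%:E -> hsum f l.
Proof.
move=> f0; rewrite esum_fsetE => fl d d0.
have : ((l - d)%:E < ereal_sup [set (\sum_(i <- J) f i)%:E | J in [set: {fset I}]])%E.
  by rewrite fl lte_fin ltrBlDr ltrDl.
move/ereal_sup_gt => [_ [J0 _ <-]]; rewrite lte_fin => dJ0.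
exists J0 => J J0J; rewrite ltr_distl.
apply/andP; split.
  by apply: lt_le_trans dJ0 _; exact: sum_fset_le.
apply: (@le_lt_trans _ _ l); last by rewrite ltrDl.
by rewrite -lee_fin -fl; apply: ereal_sup_ubound; exists J.
Qed.

Lemma hsum_ub f l J : (forall i, 0 <= f i) -> hsum f l -> \sum_(i <- J) f i <= l.
Proof.
move=> f0 fl; apply/ler_addgt0Pr => d d0; have [J0 h] := fl _ d0.
apply: (le_trans (sum_fset_le f0 (fsubsetUl J J0))).
by have := h _ (fsubsetUr J J0); rewrite ltr_distl => /andP[_ /ltW].
Qed.

Lemma hsum_esum f l : (forall i, 0 <= f i) -> hsum f l ->
  \esum_(i in [set: I]) (f i)%:E = l%:E.
Proof.
move=> f0 fl; rewrite esum_fsetE; apply/eqP; rewrite eq_le; apply/andP; split.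
  apply: ge_ereal_sup => _ [J _ <-]; rewrite lee_fin; exact: hsum_ub.
apply/lee_addgt0Pr => d d0; have [J0 h] := fl _ d0.
have := h J0 (fsubset_refl _); rewrite ltr_distl => /andP[dJ _].
rewrite (@le_trans _ _ (\sum_(i <- J0) f i + d)%:E)//.
  by rewrite lee_fin; lra.
by rewrite EFinD leeD2r//; apply: ereal_sup_ubound; exists J0.
Qed.

Lemma hsum_supp f (F : {fset I}) : (forall i, i \notin F -> f i = 0) -> hsum f (\sum_(i <- F) f i).
Proof.
move=> f0 d d0; exists F => J FJ.
by rewrite (big_fset_incl _ FJ) ?subrr ?normr0// => i _; exact: f0.
Qed.

Lemma hsum_finite f l (c : R) : 0 < c -> (forall i, 0 <= f i) -> hsum f l ->
  finite_set [set i | c <= f i].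
Proof.
move=> c0 f0 fl; apply: contrapT => /infinite_set_fset.
(* More than [l / c] terms, each at least [c], would have a sum exceeding [l]. *)
move=> /(_ (Num.bound (l / c)))[F Fc Fn].
have l0 : 0 <= l by have := hsum_ub fset0 f0 fl; rewrite big_seq_fset0.
have : l < (Num.bound (l / c))%:R * c.
  rewrite -ltr_pdivrMr//; apply: archi_boundP.
  by rewrite divr_ge0// ltW.
apply/negP; rewrite -leNgt; apply: le_trans (hsum_ub F f0 fl).
apply: (@le_trans _ _ (\sum_(i <- F) c)).
  by rewrite big_const_seq count_predT iter_addr_0 -[leRHS]mulr_natl ler_pM2r// ler_nat.
by rewrite !big_seq ler_sum// => i iF; exact: Fc.
Qed.

End UnconditionalSums.

Section OrthonormalSeries.
Variables (R : realType) (H : hilbertType R) (I : choiceType) (e : I -> H).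
Hypothesis e_on : forall i j, <| e i, e j |> = (i == j)%:R.
Implicit Types (a : I -> R[i]) (J : {fset I}) (x : H).

Lemma sqn_on i : sqn (e i) = 1.
Proof. by rewrite /sqn e_on eqxx. Qed.

Let comb a J := \sum_(i <- J) a i *: e i.

Let comb_coef a J k : k \in J -> <| comb a J, e k |> = a k.
Proof.
move=> kJ; rewrite ip_sum_l (big_fsetD1 k)//= ipZl e_on eqxx mulr1 big1_fset ?addr0//.
by move=> i; rewrite !inE => /andP[ik _] _; rewrite ipZl e_on (negPf ik) mulr0.
Qed.

Let rip_comb x a J : (forall i, i \in J -> <| x, e i |> = a i) ->
  rip x (comb a J) = \sum_(i <- J) absq (a i).
Proof.
move=> xa; rewrite ripC /rip ip_sum_l raddf_sum/= !big_seq; apply: eq_bigr => i iJ.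
by rewrite ipZl ipC xa// mul_conj.
Qed.

Let sqn_comb a J : sqn (comb a J) = \sum_(i <- J) absq (a i).
Proof. by rewrite -(@rip_comb (comb a J)) // => i; exact: comb_coef. Qed.

Let sqn_sub_comb x a J : (forall i, i \in J -> <| x, e i |> = a i) ->
  sqn (x - comb a J) = sqn x - \sum_(i <- J) absq (a i).
Proof. by move=> xa; rewrite sqnB (rip_comb xa) sqn_comb; ring. Qed.

Lemma bessel x J : \sum_(i <- J) absq <| x, e i |> <= sqn x.
Proof.
by rewrite -subr_ge0 -(@sqn_sub_comb x (fun i => <| x, e i |>))// sqn_ge0.
Qed.

(** By Pythagoras, squared distances between nested partial sums are differences of the sums of
    [absq (a i)], so the partial sums are Cauchy and [H] is complete. *)
Lemma riesz_fischer a l : hsum (fun i => absq (a i)) l ->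
  exists2 z, (forall i, <| z, e i |> = a i) & hsum (fun i => absq (a i)) (sqn z).
Proof.
move=> al.
have /cauchy_cvg acv : cauchy (comb a @ totally).
  apply: cauchy_exP => _ /complex_gt0P[r r0 ->].
  have d0 : 0 < r ^+ 2 / 2 by rewrite divr_gt0// exprn_gt0.
  have [J0 alJ] := al _ d0; exists (comb a J0); exists J0 => // J /= J0J.
  apply/ball_sqn => //.
  rewrite -opprB sqnN sqn_sub_comb => [|i iJ0].
    2: by apply: comb_coef; exact: (fsubsetP J0J).
  rewrite sqn_comb.
  have := alJ _ J0J; have := alJ _ (fsubset_refl _); rewrite !ltr_distl.
  by move=> /andP[? ?] /andP[? ?]; lra.
have /cvg_ex[z az] := acv _.
have {}az d : 0 < d -> exists J0, forall J, (J0 `<=` J)%fset -> sqn (z - comb a J) < d.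
  by move=> d0; have [J0 _ h] := az _ (sqn_nbhs z d0); exists J0 => J J0J; exact: h.
have za i : <| z, e i |> = a i.
  apply/eqP; rewrite -subr_eq0; apply/eqP/absq_eq0/eqP.
  rewrite eq_le absq_ge0 andbT; apply/ler_addgt0Pr => d d0; rewrite add0r.
  have [J0 h] := az _ d0.
  (* Adjoining [i] makes the [i]-th coefficient of the partial sum exactly [a i]. *)
  have := h (i |` J0)%fset (fsubsetU1 _ _); move=> /ltW; apply: le_trans.
  rewrite -(@comb_coef a (i |` J0)%fset) ?fset1U1// -ipBl.
  by apply: bessel1; exact: sqn_on.
exists z => // d d0; have [J0 h] := az _ d0; exists J0 => J /h.
rewrite sqn_sub_comb// => zJ; rewrite distrC ger0_norm//.
by rewrite -(@sqn_sub_comb z a)// sqn_ge0.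
Qed.

Hypothesis e_max : forall x, (forall i, <| x, e i |> = 0) -> x = 0.

(** Bessel makes the coefficients square-summable, Riesz-Fischer gives a vector with these
    coefficients, and maximality of [e] identifies it with [x]. *)
Lemma parseval x : hsum (fun i => absq <| x, e i |>) (sqn x).
Proof.
pose f i := absq <| x, e i |>; have f0 i : 0 <= f i by exact: absq_ge0.
have fx : (\esum_(i in [set: I]) (f i)%:E <= (sqn x)%:E)%E.
  rewrite esum_fsetE; apply: ge_ereal_sup => _ [J _ <-]; rewrite lee_fin; exact: bessel.
have /esum_hsum h : \esum_(i in [set: I]) (f i)%:E =
    (fine (\esum_(i in [set: I]) (f i)%:E))%:E.
  rewrite fineK// ge0_fin_numE ?(le_lt_trans fx) ?ltry//.
  by apply: esum_ge0 => i _; rewrite lee_fin.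
have [z zx xz] := riesz_fischer (h f0).
suff -> : x = z by apply: eq_hsum xz => i; rewrite zx.
apply/eqP; rewrite -subr_eq0; apply/eqP/e_max => i.
by rewrite ipBl zx subrr.
Qed.

Lemma onb_ext x y : (forall i, <| x, e i |> = <| y, e i |>) -> x = y.
Proof.
move=> xy; apply/eqP; rewrite -subr_eq0; apply/eqP/e_max => i.
by rewrite ipBl xy subrr.
Qed.

End OrthonormalSeries.

(** * Spectral theorem for compact self-adjoint contractions *)

Section SpectralTheorem.
Variables (R : realType) (H : hilbertType R) (A : {linear H -> H}).
Hypotheses (Asa : is_adjoint A A) (Actr : forall x, sqn (A x) <= sqn x).
Hypothesis Acpt : compact_op A.
Implicit Types (E : set H) (x y z : H).

Let orth E := [set x | forall e, E e -> <| x, e |> = 0].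

(** The images of the nested sets [G d] generate a filter on a precompact set, so it has a cluster
    point; this stands in for extracting a subsequence. *)
Let compact_cluster (G : R -> set H) :
  (forall d, 0 < d -> G d !=set0) -> (forall d x, G d x -> sqn x <= 1) ->
  (forall d d' x, d <= d' -> G d x -> G d' x) ->
  exists y, forall d, 0 < d -> exists2 x, G d x & sqn (A x - y) < d.
Proof.
move=> G0 G1 Gle.
pose F := filter_from [set d : R | 0 < d] (fun d => A @` G d).
have FF : ProperFilter F.
  apply: filter_from_proper; last first.
    by move=> d d0; have [x Gx] := G0 _ d0; exists (A x), x.
  apply: filter_from_filter; first by exists 1 => /=.
  move=> d d' /= d0 d'0; exists (Num.min d d') => /=; first by rewrite lt_min d0.
  move=> _ [x Gx <-]; split; exists x => //; apply: Gle Gx; rewrite ge_min lexx ?orbT//.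
have := Acpt; rewrite /compact_op precompactE => /(_ F FF)[|y [_ Fy]].
  exists 1 => //=; apply: subset_trans (@subset_closure _ _).
  move=> _ [x Gx <-]; exists x => //=.
  by have := norm_leE x (ler01 (R := R)); rewrite expr1n => ->; exact: G1 Gx.
exists y => d d0.
have [|_ /= [[x Gx <-] xy]] := Fy (A @` G d) _ _ (sqn_nbhs y d0); first by exists d.
by exists x => //; rewrite -opprB sqnN.
Qed.

(* A limit point of approximate eigenvectors [x] is found as [s^-1 A y], for [y] a
   cluster point of the [A x]. *)
Let eigen_square (E : set H) (s : R) : (forall e, E e -> sqn e = 1) -> 0 < s ->
  (forall d, 0 < d -> exists x,
     [/\ orth E x, sqn x = 1 & sqn (A (A x) - s%:C *: x) < d]) ->
  exists z, [/\ orth E z, z != 0 & A (A z) = s%:C *: z].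
Proof.
move=> E1 s0 hs.
pose G d := [set x | [/\ orth E x, sqn x = 1 & sqn (A (A x) - s%:C *: x) < d]].
have [y Gy] : exists y, forall d, 0 < d -> exists2 x, G d x & sqn (A x - y) < d.
  apply: compact_cluster => [d /hs [x]|d x [_ -> _]|d d' x dd' [Ex x1 xd]] //.
  - by exists x.
  - by split=> //; exact: lt_le_trans xd dd'.
pose z := s^-1%:C *: A y.
have sz : s%:C *: z = A y by rewrite scalerA -rmorphM/= mulfV ?gt_eqF// scale1r.
have near d : 0 < d -> exists x, [/\ orth E x, sqn x = 1,
    sqn (A (A x) - s%:C *: x) < d & sqn (z - x) < d].
  (* The bound 1 keeps the residue below [d]; [s ^+ 2 / 4] absorbs the factor 4 from applying
     [sqnB_le] to two terms below [d * c]. *)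
  move=> d0; pose c := Num.min 1 (s ^+ 2 / 4).
  have c0 : 0 < c by rewrite lt_min ltr01 divr_gt0// exprn_gt0.
  have [|x [Ex x1 xd] xy] := Gy (d * c); first exact: mulr_gt0.
  exists x; split => //.
    by apply: lt_le_trans xd _; rewrite ler_piMr ?(ltW d0)// ge_min lexx.
  have : sqn (s%:C *: (z - x)) < s ^+ 2 * d.
    rewrite scalerBr sz.
    have -> : A y - s%:C *: x = (A (A x) - s%:C *: x) - A (A x - y).
      by rewrite linearB; vec.
    apply: le_lt_trans (sqnB_le _ _) _.
    have := Actr (A x - y).
    have : d * c <= d * (s ^+ 2 / 4) by rewrite ler_pM2l// ge_min lexx orbT.
    lra.
  by rewrite sqnZr ltr_pM2l// exprn_gt0.
exists z; split.
- move=> e Ee; apply/absq_eq0/eqP; rewrite eq_le absq_ge0 andbT.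
  apply/ler_addgt0Pr => d d0; rewrite add0r.
  have [x [Ex x1 _ xz]] := near _ d0.
  have := bessel1 (z - x) (E1 _ Ee); rewrite ipBl (Ex _ Ee) subr0.
  by move/le_trans; apply; exact: ltW.
- apply/eqP => z0; have [|x [_ x1 _]] := near 1; first by [].
  by rewrite z0 sub0r sqnN x1 ltxx.
- apply/eqP; rewrite -subr_eq0; apply/eqP/sqn_eq0/eqP.
  rewrite eq_le sqn_ge0 andbT; apply/ler_addgt0Pr => d d0; rewrite add0r.
  (* With residue and [sqn (z - x)] below e = [d / c], [sqnD_le] and [sqnB_le] give the bound 2 (e +
     2 (e + s^2 e)) = (6 + 4 s^2) e. *)
  pose c := 6 + 4 * s ^+ 2.
  have c0 : 0 < c by rewrite /c; have := sqr_ge0 s; lra.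
  have [|x [_ _ xd xz]] := near (d / c); first exact: divr_gt0.
  have -> : A (A z) - s%:C *: z =
      (A (A x) - s%:C *: x) + (A (A (z - x)) - s%:C *: (z - x)).
    by rewrite !linearB/=; vec.
  have h1 := sqnD_le (A (A x) - s%:C *: x) (A (A (z - x)) - s%:C *: (z - x)).
  have h2 := sqnB_le (A (A (z - x))) (s%:C *: (z - x)).
  have h3 := Actr (A (z - x)); have h4 := Actr (z - x).
  have h5 := sqnZr s (z - x).
  have h6 : s ^+ 2 * sqn (z - x) <= s ^+ 2 * (d / c).
    by rewrite ler_wpM2l ?sqr_ge0// ltW.
  have h7 : d = 6 * (d / c) + 4 * (s ^+ 2 * (d / c)).
    by rewrite /c; field; rewrite gt_eqF.
  lra.
Qed.

(* For [s] the supremum of |A x|^2 over the unit vectors of [orth E],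
   |A^2 x - s x|^2 <= s (s - |A x|^2). *)
Let max_sqn E : (forall e, E e -> sqn e = 1) ->
  (exists2 x, orth E x & A x != 0) -> (forall x, orth E x -> orth E (A x)) ->
  exists2 s : R, 0 < s & forall d, 0 < d -> exists x,
     [/\ orth E x, sqn x = 1 & sqn (A (A x) - s%:C *: x) < d].
Proof.
move=> E1 [x0 Ex0 Ax0] Einv.
have orthZ a x : orth E x -> orth E (a *: x).
  by move=> Ex e Ee; rewrite ipZl Ex// mulr0.
pose U := [set sqn (A x) | x in [set x | orth E x /\ sqn x = 1]].
have normalize x : orth E x -> x != 0 -> exists2 r : R, 0 < r & U (r * sqn (A x)) /\ r * sqn x = 1.
  move=> Ex /sqn_gt0 x0'; exists (sqn x)^-1; first by rewrite invr_gt0.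
  split; last by rewrite mulVf// gt_eqF.
  exists ((Num.sqrt (sqn x)^-1)%:C *: x).
    by split; [exact: orthZ|rewrite sqnZr sqr_sqrtr ?invr_ge0 ?ltW// mulVf// gt_eqF].
  by rewrite linearZ/= sqnZr sqr_sqrtr// invr_ge0 ltW.
have supU : has_sup U.
  have [|r r0 [Ur _]] := normalize x0 Ex0.
    by apply: contraNN Ax0 => /eqP ->; rewrite linear0.
  split; first by exists (r * sqn (A x0)).
  by exists 1 => _ [x [_ x1] <-]; rewrite -x1.
pose s := sup U.
have Us x : orth E x -> sqn (A x) <= s * sqn x.
  move=> Ex; have [->|xn0] := eqVneq x 0; first by rewrite linear0 sqn0 mulr0.
  have [r r0 [Ur r1]] := normalize x Ex xn0.
  rewrite -(ler_pM2l r0) mulrCA r1 mulr1.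
  exact: sup_upper_bound.
have s0 : 0 < s.
  have := Us _ Ex0; have := sqn_gt0 Ax0; have := sqn_ge0 x0 => h1 h2 h3.
  rewrite ltNge; apply/negP => s0.
  have : s * sqn x0 <= 0 by rewrite mulr_le0_ge0.
  lra.
exists s => // d d0.
have ds : 0 < d / s by rewrite divr_gt0.
have [_ [x [Ex x1] <-]] := sup_adherent ds supU; rewrite -/s => sx.
exists x; split => //.
have := Us _ (Einv _ Ex); rewrite sqnB sqnZr x1 mulr1 => h.
have -> : rip (A (A x)) (s%:C *: x) = s * sqn (A x).
  by rewrite /rip ipZr Asa ipxx conj_Creal ?complex_real// -rmorphM.
suff : s * (s - sqn (A x)) < d by lra.
by rewrite mulrC -ltr_pdivlMr//; lra.
Qed.

(** Zorn gives a maximal orthonormal set of eigenvectors. Its orthogonal complement is invariant and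
    contains no eigenvector, so [A] vanishes there by the variational argument; a nonzero vector in
    it would then be an eigenvector for 0. *)
Theorem spectral_theorem : exists (I : choiceType) (g : I -> H) (mu : I -> R),
  orthonormal_basis g /\ forall i, A (g i) = (mu i)%:C *: g i.
Proof.
pose orthn (E : set H) := (forall x y, E x -> E y -> <| x, y |> = (x == y)%:R) /\
  forall x, E x -> exists mu : R, A x = mu%:C *: x.
have [F Fo Ft|E [[Eo Eev] Emax]] := @Zorn_bigcup H orthn.
  split=> [x y [B FB Bx] [C FC Cy]|x [B FB Bx]]; last exact: (Fo _ FB).2.
  by have [BC|CB] := Ft _ _ FB FC;
    [apply: (Fo _ FC).1 => //; apply: BC|apply: (Fo _ FB).1 => //; apply: CB].
have E1 e : E e -> sqn e = 1 by move=> Ee; rewrite /sqn Eo// eqxx.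
have Einv x : orth E x -> orth E (A x).
  move=> Ex e Ee; rewrite Asa; have [mu ->] := Eev _ Ee.
  by rewrite ipZr Ex// mulr0.
have no_eigen x (mu : R) : orth E x -> A x = mu%:C *: x -> x = 0.
  move=> Ex Ax; apply/eqP/negPn/negP => x0.
  pose r := Num.sqrt (sqn x)^-1; pose u := r%:C *: x.
  have Eu e : E e -> <| u, e |> = 0 by move=> Ee; rewrite ipZl Ex// mulr0.
  have uu : <| u, u |> = 1.
    rewrite ipxx sqnZr sqr_sqrtr ?invr_ge0 ?sqn_ge0// mulVf// gt_eqF//.
    exact: sqn_gt0.
  have nEu : ~ E u by move=> /Eu; rewrite uu => /eqP; rewrite oner_eq0.
  apply: (Emax (E `|` [set u])).
    by split=> [|/(_ u) uE]; [left|apply/nEu/uE; right].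
  split=> [y z [Ey|->] [Ez|->]|y [/Eev//|->]].
  - exact: Eo.
  - by rewrite ip_eq0C ?Eu//; case: eqP => // yu; rewrite -yu in nEu.
  - by rewrite Eu//; case: eqP => // yu; rewrite yu in nEu.
  - by rewrite uu eqxx.
  - by exists mu; rewrite /u linearZ/= Ax !scalerA mulrC.
have A0 x : orth E x -> A x = 0.
  move=> Ex; apply/eqP/negPn/negP => Ax0.
  have [|s s0 hs] := max_sqn E1 _ Einv; first by exists x.
  have [z [Ez z0 Az]] := eigen_square E1 s0 hs.
  (* (A - m) (A + m) z = 0, so z or A z + m z is an eigenvector. *)
  pose m := Num.sqrt s; have m2 : m%:C * m%:C = s%:C :> R[i].
    by rewrite -rmorphM/= -expr2 sqr_sqrtr// ltW.
  have /no_eigen w0 : A (A z + m%:C *: z) = m%:C *: (A z + m%:C *: z).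
    by rewrite linearD linearZ/= Az scalerDr scalerA m2 addrC.
  have /no_eigen : A z = (- m)%:C *: z.
    apply/eqP; rewrite rmorphN/= scaleNr -addr_eq0 w0// => e Ee.
    by rewrite ipDl ipZl Einv// Ez// mulr0 addr0.
  by move=> /(_ Ez) /eqP; apply/negP.
have /choice[mu Amu] (i : set_type E) : exists mu : R, A (val i) = mu%:C *: val i.
  by apply: Eev; exact: set_valP.
exists (set_type E), val, mu; split=> //; split=> [i j|x xE].
  by rewrite Eo -?val_eqE//; apply: set_valP.
have Ex : orth E x by move=> e Ee; have := xE (exist _ e (mem_set Ee)).
by apply: (no_eigen x 0 Ex); rewrite scale0r A0.
Qed.

End SpectralTheorem.

(** * Powers and moduli of operators *)

Section PositiveOperators.
Variables (R : realType) (H : hilbertType R).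
Implicit Types (S T : {linear H -> H}) (x y : H).

(** Polarization over the complex scalars: the quadratic form is real at x, y, x + y and x + iy,
    which fixes the real and imaginary parts. *)
Lemma positive_selfadjoint S : (forall x, 0 <= <| S x, x |>) -> is_adjoint S S.
Proof.
move=> S0 x y.
have im0 z : complex.Im <| S z, z |> = 0 by exact/ger0_Im/S0.
have := im0 (x + y); have := im0 (x + 'i%C *: y).
rewrite !(linearD S) (linearZ_LR S)/= !ipDl !ipDr !ipZl !ipZr [X in _ -> _ -> _ = X]ipC.
have := im0 x; have := im0 y.
case: <| S x, x |> => a b; case: <| S y, y |> => c d.
case: <| S x, y |> => p q; case: <| S y, x |> => r s /=.
move=> -> -> h1 h2; apply/eqP; rewrite eq_complex/=; apply/andP.
by split; apply/eqP; lra.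
Qed.

Lemma op_powD T m n x : op_pow T (m + n) x = op_pow T m (op_pow T n x).
Proof. exact: iterD. Qed.

Lemma op_pow_eigen T (a : R[i]) x n : T x = a *: x -> op_pow T n x = a ^+ n *: x.
Proof.
move=> Tx; elim: n => [|n IH]; first by rewrite expr0 scale1r.
by rewrite /op_pow/= -/(op_pow T n x) IH linearZ/= Tx scalerA -exprSr.
Qed.

Lemma op_pow_adjoint T n : is_adjoint T T -> is_adjoint (op_pow T n) (op_pow T n).
Proof.
move=> Tsa; elim: n => [//|n IH] x y.
by rewrite -[in RHS]addn1 op_powD /op_pow /= -/(op_pow T n x) Tsa IH.
Qed.

Lemma op_pow_bounded T n : bounded_op T -> bounded_op (op_pow T n).
Proof.
move=> [M TM]; exists (`|M| ^+ n) => x; elim: n => [|n IH].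
  by rewrite expr0 mul1r.
rewrite /op_pow/= -/(op_pow T n x) exprS -mulrA.
apply: le_trans (TM _) _; apply: (@le_trans _ _ (`|M| * `|op_pow T n x|)).
  have Mx : 0 <= M * `|op_pow T n x| by apply: le_trans (TM _).
  by rewrite -[leLHS]ger0_norm// normrM normr_id.
exact: ler_wpM2l.
Qed.

(** Write n = 2m + r with r at most 1 and move S^m across: the form becomes <S^r (S^m x), S^m x>. *)
Lemma op_pow_positive S n : positive_op S -> positive_op (op_pow S n).
Proof.
move=> [bS S0]; split; first exact: op_pow_bounded.
have Ssa := positive_selfadjoint S0.
move=> x /=; rewrite -(odd_double_half n) -addnn; set m := n./2.
rewrite addnCA op_powD (op_pow_adjoint m Ssa) op_powD.
case: (odd n) => /=; first exact: S0.
by rewrite ipxx lecR sqn_ge0.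
Qed.

(** The adjoint in [is_modulus] must be [T] itself, so S^2 = T^2 and S^(2n) = T^(2n). *)
Lemma is_modulus_pow T S n : is_adjoint T T -> is_modulus T S ->
  is_modulus (op_pow T n) (op_pow S n).
Proof.
move=> Tsa [Spos [T' TT' SS]]; split; first exact: op_pow_positive.
exists (op_pow T n); first exact: op_pow_adjoint.
have T'E y : T' y = T y.
  by apply: ip_ext => z; rewrite ipC -TT' Tsa -ipC.
move=> x /=; rewrite -!op_powD addnn; elim: n => [//|n IH].
by rewrite doubleS /op_pow/= -/(op_pow S n.*2 x) -/(op_pow T n.*2 x) IH SS T'E.
Qed.

(** For a nonzero, w = S x - |a| x satisfies S w = -|a| w, which positivity of [S] allows only for w
    = 0. For a = 0, |S x|^2 = <S^2 x, x> = 0. *)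
Lemma modulus_eigen T S (a : R) x : is_adjoint T T -> is_modulus T S ->
  T x = a%:C *: x -> S x = `|a|%:C *: x.
Proof.
move=> Tsa TS Tx; have [[_ S0] [T' TT' SS]] := TS.
have T'E y : T' y = T y.
  by apply: ip_ext => z; rewrite ipC -TT' Tsa -ipC.
have SSx : S (S x) = (a ^+ 2)%:C *: x.
  by rewrite SS T'E Tx linearZ/= Tx scalerA -rmorphM -expr2.
have Ssa := positive_selfadjoint S0.
have [a0|a0] := eqVneq a 0.
  rewrite a0 normr0 scale0r; apply: sqn_eq0.
  by rewrite /sqn -Ssa SSx a0 expr0n scale0r ip0l.
pose w := S x - `|a|%:C *: x.
have Sw : S w = (- `|a|)%:C *: w.
  rewrite /w linearB linearZ/= SSx scalerBr scalerA rmorphN/= mulNr -rmorphM/= -expr2.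
  by rewrite real_normK ?num_real// !scaleNr opprK addrC.
have : w = 0.
  apply/eqP/negPn/negP => /sqn_gt0 w0.
  have := S0 w; rewrite Sw ipZl ipxx -rmorphM/= lecR mulNr oppr_ge0.
  by apply/negP; rewrite -ltNge mulr_gt0// normr_gt0.
by move/eqP; rewrite subr_eq0 => /eqP.
Qed.

(** As T^n is a contraction, T^(n+1) maps the unit ball into its image under [T], which gives
    compactness; the modulus is S^(n+1). *)
Lemma schatten_pow T n : (forall x, sqn (T x) <= sqn x) -> is_adjoint T T ->
  schatten n.+1 T -> trace_class (op_pow T n.+1).
Proof.
move=> Tctr Tsa [Tcpt [S TS St]]; split.
  apply: precompact_subset Tcpt => _ [x x1 <-] /=.
  exists (op_pow T n x) => //=; move: x1 => /=.
  have := norm_leE _ (ler01 (R := R)); rewrite expr1n => nE; rewrite !nE.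
  apply: le_trans; elim: n {S TS St} => [//|n]; apply: le_trans; exact: Tctr.
by exists (op_pow S n.+1) => //; exact: is_modulus_pow.
Qed.

End PositiveOperators.

(** * Traces of diagonal operators *)

Section DoubleSums.
Variables (R : realType) (I J : choiceType).

Lemma esum_swap (F : I -> J -> R) : (forall i j, 0 <= F i j) ->
  \esum_(i in [set: I]) \esum_(j in [set: J]) (F i j)%:E =
  \esum_(j in [set: J]) \esum_(i in [set: I]) (F i j)%:E.
Proof.
move=> F0; rewrite !esum_esum; try by move=> *; rewrite lee_fin.
rewrite (reindex_esum ([set: J] `*`` (fun=> [set: I])) _ (fun p => (p.2, p.1)))//.
split => [[j i] //|[j i] [j' i'] _ _ [-> ->] //|[i j] _].
by exists (j, i).
Qed.

Lemma esum_fin (f h : I -> R) (l : R) : (forall i, 0 <= f i <= h i) ->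
  \esum_(i in [set: I]) (h i)%:E = l%:E ->
  exists2 m : R, 0 <= m & \esum_(i in [set: I]) (f i)%:E = m%:E.
Proof.
move=> fh hl.
have f0 i : 0 <= f i by case/andP: (fh i).
have s0 : (0 <= \esum_(i in [set: I]) (f i)%:E)%E.
  by apply: esum_ge0 => i _; rewrite lee_fin.
have : (\esum_(i in [set: I]) (f i)%:E <= l%:E)%E.
  by rewrite -hl; apply: le_esum => i _; rewrite lee_fin; case/andP: (fh i).
move: s0; case: (\esum_(i in _) _) => [m m0 _| //|//].
by exists m.
Qed.

End DoubleSums.

Section DiagonalTrace.
Variables (R : realType) (H : hilbertType R).

(** Basis independence of the trace for nonnegative weights: swap the sums and apply Parseval to
    each [g i] in the basis [e]. *)
Lemma onb_weight (I J : choiceType) (g : I -> H) (e : J -> H) (w : I -> R) :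
  orthonormal_basis g -> orthonormal_basis e -> (forall i, 0 <= w i) ->
  \esum_(j in [set: J]) \esum_(i in [set: I]) (w i * absq <| e j, g i |>)%:E =
  \esum_(i in [set: I]) (w i)%:E.
Proof.
move=> [g1 g2] [e1 e2] w0.
rewrite esum_swap => [|j i]; last by rewrite mulr_ge0// absq_ge0.
apply: eq_esum => i _; apply: hsum_esum => [j|].
  by rewrite mulr_ge0// absq_ge0.
have := hsumZ (w i) (parseval e1 e2 (g i)); rewrite sqn_on// mulr1.
by apply: eq_hsum => j; rewrite -absqJ -ipC.
Qed.

Variables (T : {linear H -> H}) (I : choiceType) (g : I -> H).
Hypotheses (Tsa : is_adjoint T T) (g_onb : orthonormal_basis g).
Variables (wp wm : I -> R) (Wp Wm : R).
Hypotheses (Tg : forall i, T (g i) = (wp i - wm i)%:C *: g i).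
Hypotheses (wp0 : forall i, 0 <= wp i) (wm0 : forall i, 0 <= wm i).
Hypothesis wpE : \esum_(i in [set: I]) (wp i)%:E = Wp%:E.
Hypothesis wmE : \esum_(i in [set: I]) (wm i)%:E = Wm%:E.

Lemma quadratic_hsum x :
  hsum (fun i => (wp i - wm i) * absq <| x, g i |>) (complex.Re <| T x, x |>).
Proof.
have [g1 g2] := g_onb.
(* polarization: |x + T x|^2 - |x - T x|^2 = 4 <T x, x> *)
have := hsumZ 4^-1 (hsumB (parseval g1 g2 (x + T x)) (parseval g1 g2 (x - T x))).
rewrite sqnB sqnD -/(rip (T x) x) (ripC (T x) x).
have -> : 4^-1 * (sqn x + sqn (T x) + 2 * rip x (T x)
   - (sqn x + sqn (T x) - 2 * rip x (T x))) = rip x (T x) by field.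
apply: eq_hsum => i; rewrite ipBl ipDl Tsa Tg ipZr.
rewrite conj_Creal ?complex_real//; move: (wp i - wm i) => r.
have -> : <| x, g i |> + r%:C * <| x, g i |> = (1 + r)%:C * <| x, g i |>.
  by rewrite -[X in X + _]mul1r -mulrDl rmorphD.
have -> : <| x, g i |> - r%:C * <| x, g i |> = (1 - r)%:C * <| x, g i |>.
  by rewrite -[X in X - _]mul1r -mulrBl rmorphB.
by rewrite !absqM !absqR; field.
Qed.

Let wsum w W x : (forall i, 0 <= w i) -> \esum_(i in [set: I]) (w i)%:E = W%:E ->
  exists2 m : R, 0 <= m & \esum_(i in [set: I]) (w i * absq <| x, g i |>)%:E = m%:E.
Proof.
have [g1 _] := g_onb.
move=> w0 wW; apply: (@esum_fin _ _ _ (fun i => sqn x * w i) (sqn x * W)).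
  move=> i; rewrite mulr_ge0 ?absq_ge0//= mulrC ler_wpM2r//.
  by apply: bessel1; exact: sqn_on.
apply: hsum_esum => [i|]; first by rewrite mulr_ge0 ?sqn_ge0.
exact/hsumZ/esum_hsum.
Qed.

(** Splitting the eigenvalues into two nonnegative summable families reduces the signed double sum
    to two uses of [onb_weight]. *)
Lemma diag_hsum (J : choiceType) (e : J -> H) : orthonormal_basis e ->
  hsum (fun j => complex.Re <| T (e j), e j |>) (Wp - Wm).
Proof.
move=> e_onb.
have /choice[ap apE] j : exists m : R, 0 <= m /\
    \esum_(i in [set: I]) (wp i * absq <| e j, g i |>)%:E = m%:E.
  by have [m m0 mE] := wsum (e j) wp0 wpE; exists m.
have /choice[am amE] j : exists m : R, 0 <= m /\
    \esum_(i in [set: I]) (wm i * absq <| e j, g i |>)%:E = m%:E.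
  by have [m m0 mE] := wsum (e j) wm0 wmE; exists m.
have TE j : ap j - am j = complex.Re <| T (e j), e j |>.
  apply: hsum_uniq (quadratic_hsum (e j)).
  have hp := esum_hsum (fun i => mulr_ge0 (wp0 i) (absq_ge0 _)) (apE j).2.
  have hm := esum_hsum (fun i => mulr_ge0 (wm0 i) (absq_ge0 _)) (amE j).2.
  by apply: eq_hsum (hsumB hp hm) => i; rewrite mulrBl.
apply: (eq_hsum TE); apply: hsumB; apply: esum_hsum.
- by move=> j; case: (apE j).
- rewrite -wpE -(onb_weight g_onb e_onb wp0); apply: eq_esum => j _.
  by case: (apE j).
- by move=> j; case: (amE j).
- rewrite -wmE -(onb_weight g_onb e_onb wm0); apply: eq_esum => j _.
  by case: (amE j).
Qed.

Lemma trace_diag : trace T = (Wp - Wm)%:C.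
Proof.
have Tcvg (J : choiceType) (e : J -> H) : orthonormal_basis e ->
    partial_sum (fun i => <| T (e i), e i |> : R[i]^o) @ totally
      --> ((Wp - Wm)%:C : R[i]^o).
  move=> e_onb; apply/cvg_ballP => _ /complex_gt0P[r r0 ->].
  have [J0 h] := diag_hsum e_onb r0; exists J0 => // A /= J0A.
  rewrite -ball_normE /= /partial_sum -(big_seq_fsetE _ A predT (fun i => <| T (e i), e i |>))/=.
  have -> : \sum_(i <- A) <| T (e i), e i |> =
      (\sum_(i <- A) complex.Re <| T (e i), e i |>)%:C.
    rewrite rmorph_sum/=; apply: eq_bigr => i _; apply/esym/RRe_real/CrealP.
    by rewrite -ipC Tsa.
  rewrite -rmorphB normc_def /= expr0n addr0 ltcR sqrtr_sqr distrC.
  exact: h.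
rewrite /trace; apply: xget_unique => //= t tT.
(* Uniqueness of the limit needs at least one basis to evaluate it in. *)
have [J [e e_onb]] := orthonormal_basis_exists H.
exact: (cvg_unique _ (tT _ _ e_onb) (Tcvg _ _ e_onb)).
Qed.

End DiagonalTrace.

(** * Pairs of projections *)

Section ProjectionPair.
Variables (R : realType) (H : hilbertType R) (P Q : projection H).
Implicit Types x y : H.

Let double_eq0 x : x + x = 0 -> x = 0.
Proof.
move=> xx; apply: sqn_eq0; have := sqnD x x.
by rewrite xx sqn0 -[rip x x]/(sqn x); lra.
Qed.

(** The operator B of the sketch, with A being [P \- Q]. *)
Definition codiff x := x - P x - Q x.

Lemma codiff_adjoint : is_adjoint codiff codiff.
Proof.
by move=> x y; rewrite /codiff !ipBl !ipBr !(proj_selfadjoint x y).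
Qed.

Lemma sub_proj_adjoint : is_adjoint (P \- Q) (P \- Q).
Proof. by move=> x y /=; rewrite !ipBl !ipBr !(proj_selfadjoint x y). Qed.

Lemma sub_codiff_anticomm x : (P \- Q) (codiff x) = - codiff ((P \- Q) x).
Proof. by rewrite /codiff /= !linearB/= !proj_idem; vec. Qed.

Lemma sub_codiff_sq x : (P \- Q) ((P \- Q) x) + codiff (codiff x) = x.
Proof. by rewrite /codiff /= !linearB/= !proj_idem; vec. Qed.

Lemma sqn_sub_codiff x : sqn ((P \- Q) x) + sqn (codiff x) = sqn x.
Proof.
rewrite /sqn sub_proj_adjoint codiff_adjoint -raddfD -ipDr; congr (complex.Re <| _, _ |>).
exact: sub_codiff_sq.
Qed.

Lemma sub_proj_contraction x : sqn ((P \- Q) x) <= sqn x.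
Proof. by rewrite -[leRHS]sqn_sub_codiff lerDl sqn_ge0. Qed.

(** From |A x|^2 + |B x|^2 = |x|^2 follows B x = 0, and x - A x - B x = 2 Q x. *)
Lemma sub_proj_eigen1 x : (P \- Q) x = x -> P x = x /\ Q x = 0.
Proof.
move=> Ax; have /sqn_eq0 Bx : sqn (codiff x) = 0.
  by have := sqn_sub_codiff x; rewrite Ax; lra.
have Qx : Q x = 0.
  apply: double_eq0.
  transitivity (x - (P x - Q x) - codiff x); first by rewrite /codiff; vec.
  by rewrite Bx -[P x - Q x]/((P \- Q) x) Ax subrr subr0.
by split=> //; rewrite -[RHS]Ax /= Qx subr0.
Qed.

Lemma sub_proj_eigenN1 x : (P \- Q) x = - x -> Q x = x /\ P x = 0.
Proof.
move=> Ax; have /sqn_eq0 Bx : sqn (codiff x) = 0.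
  by have := sqn_sub_codiff x; rewrite Ax sqnN; lra.
have Px : P x = 0.
  apply: double_eq0.
  transitivity (x + (P x - Q x) - codiff x); first by rewrite /codiff; vec.
  by rewrite Bx -[P x - Q x]/((P \- Q) x) Ax subrr subr0.
by split=> //; apply: oppr_inj; rewrite -Ax /= Px sub0r.
Qed.

Variables (I : choiceType) (g : I -> H) (mu : I -> R).
Hypothesis g_onb : orthonormal_basis g.
Hypothesis Ag : forall i, (P \- Q) (g i) = (mu i)%:C *: g i.

Let g1 : forall i j, <| g i, g j |> = (i == j)%:R := g_onb.1.

Lemma sqn_codiff_eigen i : sqn (codiff (g i)) = 1 - mu i ^+ 2.
Proof.
have := sqn_sub_codiff (g i); rewrite Ag sqnZr (sqn_on g1); lra.
Qed.

Lemma eigen_le1 i : mu i ^+ 2 <= 1.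
Proof. by rewrite -subr_ge0 -sqn_codiff_eigen sqn_ge0. Qed.

(** By anticommutation A (B g_i) = - mu_i B g_i, and A is self-adjoint, so B g_i is orthogonal to
    eigenvectors for any other eigenvalue. *)
Lemma codiff_eigen_neq0 i j : <| codiff (g i), g j |> != 0 -> mu j = - mu i.
Proof.
move=> ij; apply: complexI; apply: (mulIf ij).
have -> : (mu j)%:C * <| codiff (g i), g j |> = <| codiff (g i), (P \- Q) (g j) |>.
  by rewrite Ag ipZr conj_Creal ?complex_real.
rewrite -sub_proj_adjoint sub_codiff_anticomm Ag rmorphN/= mulNr -ipZl -ipNl.
by congr <| - _, _ |>; rewrite /codiff !linearZ/=; vec.
Qed.

(* Both sides are the double sum of
   phi (mu_i) / (1 - mu_i^2) * |<B g_i, g_j>|^2, in one order or the other. *)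
Lemma symmetric_spectrum (phi : R -> R) : (forall t, 0 <= phi t) ->
  phi 1 = 0 -> phi (-1) = 0 ->
  \esum_(i in [set: I]) (phi (mu i))%:E = \esum_(i in [set: I]) (phi (- mu i))%:E.
Proof.
move=> phi0 phi1 phiN1; have [_ g2] := g_onb.
(* At t = 1 and t = -1 the quotient is 0 by convention, which agrees with [phi] vanishing there. *)
pose wt t := phi t / (1 - t ^+ 2).
have wtE t : wt t * (1 - t ^+ 2) = phi t.
  have [t1|t1] := eqVneq (1 - t ^+ 2) 0; last by rewrite /wt divfK.
  rewrite t1 mulr0; have /eqP : t ^+ 2 = 1 ^+ 2 by rewrite expr1n; lra.
  by rewrite eqf_sqr => /orP[] /eqP ->.
have wtN t : phi (- t) = wt (- t) * (1 - t ^+ 2) by rewrite -wtE sqrrN.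
have wt0 t : t ^+ 2 <= 1 -> 0 <= wt t.
  by move=> t1; rewrite divr_ge0// subr_ge0.
have key w : (forall i, 0 <= w i) ->
    forall i, \esum_(j in [set: I]) (w i * absq <| codiff (g i), g j |>)%:E =
    (w i * (1 - mu i ^+ 2))%:E.
  move=> w0 i; apply: hsum_esum => [j|]; first by rewrite mulr_ge0// absq_ge0.
  by rewrite -sqn_codiff_eigen; apply/hsumZ/parseval.
transitivity (\esum_(i in [set: I]) \esum_(j in [set: I])
    (wt (mu i) * absq <| codiff (g i), g j |>)%:E).
  by apply: eq_esum => i _; rewrite (key (fun i => wt (mu i))) ?wtE// => j; exact/wt0/eigen_le1.
rewrite esum_swap => [|i j]; last first.
  by rewrite mulr_ge0 ?absq_ge0// wt0// eigen_le1.
apply: eq_esum => j _; rewrite wtN -(key (fun j => wt (- mu j))) => [|i]; last first.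
  by rewrite wt0// sqrrN eigen_le1.
apply: eq_esum => i _; congr EFin.
(* The matrix of B is Hermitian, so [absq] of its entries is symmetric; where an entry is nonzero,
   the weights agree because the eigenvalues are opposite. *)
rewrite codiff_adjoint [X in absq X]ipC absqJ.
have [->|ij] := eqVneq <| codiff (g j), g i |> 0; first by rewrite absq0 !mulr0.
by rewrite (codiff_eigen_neq0 ij).
Qed.

End ProjectionPair.

(** * Dimensions of quotients *)

Section QuotientDimension.
Variables (K : fieldType) (V : lmodType K) (A B : set V).
Hypothesis B0 : B 0.
Hypothesis BP : forall a u v, B u -> B v -> B (a *: u + v).

Let BD u v : B u -> B v -> B (u + v).
Proof. by move=> Bu Bv; rewrite -[u]scale1r; exact: BP. Qed.

Let B_sum n (c : 'rV[K]_n) (u : 'I_n -> V) :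
  (forall i, B (u i)) -> B (\sum_i c 0 i *: u i).
Proof.
by move=> Bu; elim/big_rec: _ => // i x _; exact: BP.
Qed.

(** Expanding each family in the other modulo [B] gives matrices whose product is the identity, by
    uniqueness of coordinates; ranks then give the inequality. *)
Lemma quotient_basis_le n m (b : 'I_n -> V) (b' : 'I_m -> V) :
  quotient_basis A B b -> quotient_basis A B b' -> (n <= m)%N.
Proof.
move=> [Ab bE] [Ab' b'E].
have /choice[N NE] i : exists c : 'rV[K]_m, B (b i - \sum_j c 0 j *: b' j).
  by have [c [Bc _]] := b'E _ (Ab i); exists c.
have /choice[M ME] j : exists c : 'rV[K]_n, B (b' j - \sum_l c 0 l *: b l).
  by have [c [Bc _]] := bE _ (Ab' j); exists c.
pose N' := \matrix_i N i; pose M' := \matrix_j M j.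
apply: (mulmx1_min (A := N') (B := M')); apply/row_matrixP => i.
have [c [_ c_uniq]] := bE _ (Ab i).
rewrite -(c_uniq (row i (N' *m M'))); last first.
  have -> : b i - \sum_l row i (N' *m M') 0 l *: b l =
      \sum_j N i 0 j *: (b' j - \sum_l M j 0 l *: b l) +
      (b i - \sum_j N i 0 j *: b' j).
    under [in RHS]eq_bigr do rewrite scalerBr.
    rewrite sumrB [RHS]addrC addrA subrK; congr (_ - _).
    under [RHS]eq_bigr do rewrite scaler_sumr.
    rewrite exchange_big/=; apply: eq_bigr => l _.
    rewrite !mxE scaler_suml; apply: eq_bigr => j _.
    by rewrite !mxE scalerA.
  by apply: BD => //; apply: B_sum.
apply: c_uniq; rewrite (bigD1 i)//= big1 ?addr0 => [|l li].
  by rewrite !mxE eqxx scale1r subrr.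
by rewrite !mxE eq_sym (negPf li) scale0r.
Qed.

Lemma quotient_dimE n (b : 'I_n -> V) : quotient_basis A B b -> quotient_dim A B = n.
Proof.
move=> bE; rewrite /quotient_dim; apply: xget_unique; first by exists b.
move=> m [b' b'E]; apply/eqP; rewrite eqn_leq.
by rewrite (quotient_basis_le b'E bE) (quotient_basis_le bE b'E).
Qed.

End QuotientDimension.

(** Serves both the kernel and the cokernel: inside [A], the subspace [B] is the orthogonal
    complement of [g], so coordinates are inner products. *)
Lemma orthonormal_quotient_basis (R : realType) (H : hilbertType R)
    (A B : set H) (I : finType) (g : I -> H) :
  (forall i j, <| g i, g j |> = (i == j)%:R) -> (forall i, A (g i)) ->
  (forall a u v, A u -> A v -> A (a *: u + v)) ->
  (forall v, A v -> B v <-> forall i, <| v, g i |> = 0) ->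
  quotient_basis A B (fun k : 'I_#|I| => g (enum_val k)).
Proof.
move=> g1 Ag AP AB; split=> [i|v Av]; first exact: Ag.
pose rest (c : 'rV[R[i]]_#|I|) := v - \sum_k c 0 k *: g (enum_val k).
have Arest c : A (rest c).
  rewrite /rest -sumrN; elim/big_rec: _ => [|k x _ Ax]; first by rewrite addr0.
  by rewrite addrCA -scaleNr; exact: AP.
have restE c k : <| rest c, g (enum_val k) |> = <| v, g (enum_val k) |> - c 0 k.
  rewrite ipBl ip_sum_l (bigD1 k)//= ipZl g1 eqxx mulr1 big1 ?addr0// => l lk.
  by rewrite ipZl g1 (inj_eq enum_val_inj) (negPf lk) mulr0.
exists (\row_k <| v, g (enum_val k) |>); split.
  apply/AB => [|i]; first exact: Arest.
  by rewrite -(enum_rankK i) restE mxE subrr.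
move=> c /(AB _ (Arest c)) c0; apply/rowP => k; rewrite mxE.
by apply/eqP; rewrite -subr_eq0 -restE c0.
Qed.

(** * Index of the compression and trace of the odd power *)

Section FredholmPair.
Variables (R : realType) (H : hilbertType R) (P Q : projection H) (n : nat).
Variables (I : choiceType) (g : I -> H) (mu : I -> R).
Hypothesis g_onb : orthonormal_basis g.
Hypothesis Ag : forall i, (P \- Q) (g i) = (mu i)%:C *: g i.
Hypothesis PQ_schatten : schatten n.+1 (P \- Q).

Let g1 : forall i j, <| g i, g j |> = (i == j)%:R := g_onb.1.
Let g2 : forall x, (forall i, <| x, g i |> = 0) -> x = 0 := g_onb.2.

(** The Schatten condition is evaluated in the eigenbasis, where the modulus is diagonal with
    entries [|mu i|]. *)
Lemma esum_eigen_fin : exists W : R,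
  \esum_(i in [set: I]) (`|mu i| ^+ n.+1)%:E = W%:E.
Proof.
have [_ [S AS /(_ _ _ g_onb) Sfin]] := PQ_schatten.
have SE i : complex.Re <| op_pow S n.+1 (g i), g i |> = `|mu i| ^+ n.+1.
  rewrite (op_pow_eigen _ (modulus_eigen (@sub_proj_adjoint _ _ P Q) AS (Ag i))).
  by rewrite ipZl g1 eqxx mulr1 -rmorphXn.
exists (fine (\esum_(i in [set: I]) (`|mu i| ^+ n.+1)%:E)).
rewrite fineK// ge0_fin_numE; last by apply: esum_ge0 => i _; rewrite lee_fin exprn_ge0.
by under eq_esum do rewrite -SE.
Qed.

Lemma finite_eigen (c : R) : 0 < c -> finite_set [set i | c <= `|mu i|].
Proof.
move=> c0; have [W /esum_hsum hW] := esum_eigen_fin.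
have mu0 i : 0 <= `|mu i| ^+ n.+1 by rewrite exprn_ge0.
have cn0 : 0 < c ^+ n.+1 by rewrite exprn_gt0.
apply: sub_finite_set (hsum_finite cn0 mu0 (hW mu0)) => i /= ci.
by rewrite lerXn2r ?nnegrE// ltW.
Qed.

(** [fset_set] is empty on infinite sets; for [c] of absolute value 1 [finite_eigen] excludes that
    case. *)
Definition eigen_fset (c : R) : {fset I} := fset_set [set i | mu i = c].

Lemma eigen_fsetP c i : `|c| = 1 -> (i \in eigen_fset c) = (mu i == c).
Proof.
move=> c1; rewrite in_fset_set; first by apply/idP/eqP; rewrite inE.
by apply: sub_finite_set (finite_eigen ltr01) => j /= ->; rewrite c1.
Qed.

Lemma eigen_fset_hsum c : `|c| = 1 ->
  hsum (fun i => (mu i == c)%:R : R) #|` eigen_fset c|%:R.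
Proof.
move=> c1.
have -> : #|` eigen_fset c|%:R = \sum_(i <- eigen_fset c) (mu i == c)%:R :> R.
  rewrite big_seq (eq_bigr (fun=> 1)) => [|i]; last by rewrite eigen_fsetP// => ->.
  by rewrite -big_seq big_const_seq count_predT iter_addr_0.
by apply: hsum_supp => i; rewrite eigen_fsetP// => /negPf ->.
Qed.

(* [phi] cuts off the eigenvalues outside ]0, 1[; those in ]0, 1[ and those in
   ]-1, 0[ cancel by [symmetric_spectrum]. *)
Lemma trace_odd_pow : odd n.+1 ->
  trace (op_pow (P \- Q) n.+1) =
  #|` eigen_fset 1|%:R - #|` eigen_fset (-1)|%:R.
Proof.
move=> n_odd; have [W WE] := esum_eigen_fin.
pose phi (t : R) : R := if 0 < t < 1 then t ^+ n.+1 else 0.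
have phi0 t : 0 <= phi t.
  by rewrite /phi; case: ifP => // /andP[t0 _]; rewrite exprn_ge0// ltW.
have phi_le t : phi t <= `|t| ^+ n.+1.
  rewrite /phi; case: ifP => [/andP[t0 _]|_]; last by rewrite exprn_ge0.
  by rewrite gtr0_norm.
have phi1 : phi 1 = 0 by rewrite /phi ltxx andbF.
have phiN1 : phi (-1) = 0 by rewrite /phi oppr_gt0 ltr10.
have [s s0 sE] := esum_fin (fun i => introT andP (conj (phi0 (mu i)) (phi_le (mu i)))) WE.
have sE' := symmetric_spectrum g_onb Ag phi0 phi1 phiN1; rewrite sE in sE'.
have hs c l (f : I -> R) : `|c| = 1 -> (forall i, 0 <= f i) ->
    \esum_(i in [set: I]) (f i)%:E = l%:E ->
    \esum_(i in [set: I]) (f i + (mu i == c)%:R)%:E = (l + #|` eigen_fset c|%:R)%:E.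
  move=> c1 f0 fl; under eq_esum do rewrite EFinD.
  rewrite esumD => [|i _|i _]; rewrite ?lee_fin ?ler0n//.
  by rewrite fl (hsum_esum _ (eigen_fset_hsum c1)).
(* Positive and negative parts of mu^(n+1): each is a [phi] term, both with sum [s], plus the
   indicator of the eigenvalue 1 or -1. *)
have p := hs 1 _ _ (normr1 _) (fun i => phi0 (mu i)) sE.
have m := hs (-1) _ _ (normrN1 _) (fun i => phi0 (- mu i)) (esym sE').
rewrite (trace_diag _ g_onb _ _ _ p m).
- by rewrite opprD addrACA subrr add0r rmorphB/= !rmorph_nat.
- exact/op_pow_adjoint/sub_proj_adjoint.
- move=> i; apply: etrans (op_pow_eigen n.+1 (Ag i)) _; congr (_ *: _).
  rewrite -rmorphXn; apply: (congr1 (real_complex R)).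
  have : `|mu i| <= 1.
    by rewrite -(@ler_pXn2r _ 2)// ?nnegrE// expr1n real_normK ?num_real ?(eigen_le1 g_onb Ag).
  move: (mu i) => t; rewrite ler_norml => /andP[tN1 t1].
  (* Oddness enters here: powers of negative eigenvalues belong to the negative part. *)
  have expN u : (- u) ^+ n.+1 = - u ^+ n.+1 :> R.
    by rewrite exprNn -signr_odd n_odd expr1 mulN1r.
  have [t0|t0|->] := ltgtP t 0.
  + have -> : phi t = 0 by rewrite /phi ltNge ltW.
    have -> : (t == 1) = false by rewrite lt_eqF// (lt_trans t0).
    have [->|tn1] := eqVneq t (-1); first by rewrite opprK phi1 expN expr1n !add0r.
    rewrite /phi oppr_gt0 t0 ltrNl lt_neqAle eq_sym tn1 tN1 /= expN.
    by rewrite !addr0 add0r opprK.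
  + have -> : phi (- t) = 0 by rewrite /phi oppr_gt0 ltNge ltW.
    have -> : (t == -1) = false by rewrite gt_eqF// (lt_trans _ t0)// oppr_lt0.
    have [->|tn1] := eqVneq t 1; first by rewrite phi1 expr1n !addr0 add0r subr0.
    by rewrite /phi t0 lt_neqAle tn1 t1 /= !addr0 subr0.
  + by rewrite oppr0 /phi ltxx expr0n !(eq_sym 0) oppr_eq0 oner_eq0 !addr0 subr0.
- by move=> i; rewrite addr_ge0.
- by move=> i; rewrite addr_ge0.
Qed.

Lemma sqn_proj_le (O : projection H) x : sqn (O x) <= sqn x.
Proof.
have := sqn_ge0 (x - O x); rewrite sqnB.
have -> : rip x (O x) = sqn (O x) by rewrite /rip -{1}proj_idem -proj_selfadjoint.
lra.
Qed.

Lemma eigen1_proj i : mu i = 1 -> P (g i) = g i /\ Q (g i) = 0.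
Proof. by move=> i1; apply: sub_proj_eigen1; rewrite Ag i1 scale1r. Qed.

Lemma eigenN1_proj i : mu i = -1 -> Q (g i) = g i /\ P (g i) = 0.
Proof. by move=> i1; apply: sub_proj_eigenN1; rewrite Ag i1 rmorphN scaleN1r. Qed.

Lemma prangeE (O : projection H) (x : prange O) : O (val x) = val x.
Proof. by case: x => x /=; rewrite inE => -[y _ <-]; exact: proj_idem. Qed.

Lemma mem_prange (O : projection H) x : O x = x -> x \in prange_pred O.
Proof. by move=> Ox; rewrite inE -Ox; exists x. Qed.

(** Divide the coefficients of [y] by 1 - mu_i^2; the quotients stay square-summable, so
    Riesz-Fischer produces [z]. *)
Lemma solve_one_sub_sq y : (forall i, mu i ^+ 2 = 1 -> <| y, g i |> = 0) ->
  exists z, z - (P \- Q) ((P \- Q) z) = y.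
Proof.
move=> y0; pose a i := ((1 - mu i ^+ 2)^-1)%:C * <| y, g i |>.
have half0 : 0 < 2^-1 :> R by rewrite invr_gt0.
(* The factors (1 - mu_i^2)^-1 (0 if mu_i^2 = 1) are at most 4/3 off the
   finite set [F]. *)
pose F := fset_set [set i | 2^-1 <= `|mu i|].
pose b i := if i \in F then absq (a i) else 0.
(* Off [F] the factor 4 suffices, since (4/3)^2 < 4; on [F] the finitely supported [b] dominates. *)
have [||l _ /esum_hsum al] := @esum_fin R I (fun i => absq (a i))
  (fun i => 4 * absq <| y, g i |> + 1 * b i) (4 * sqn y + 1 * \sum_(i <- F) b i).
- move=> i; rewrite absq_ge0 mul1r /b; case: ifPn => iF.
    by rewrite lerDr mulr_ge0// absq_ge0.
  rewrite addr0 absqM absqR ler_wpM2r ?absq_ge0//.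
  have {iF} : `|mu i| < 2^-1.
    by rewrite ltNge; apply: contra iF => ci; rewrite in_fset_set ?inE//; exact: finite_eigen.
  move: (mu i) => t; rewrite ltr_norml => /andP[t1 t2].
  have t3 : t ^+ 2 <= 4^-1 by nra.
  have : (1 - t ^+ 2)^-1 <= (3 / 4)^-1 by rewrite lef_pV2 ?posrE; lra.
  have : 0 <= (1 - t ^+ 2)^-1 by rewrite invr_ge0; lra.
  move: (_^-1) => u; nra.
- apply: hsum_esum => [i|].
    by rewrite mul1r addr_ge0 ?mulr_ge0 ?absq_ge0// /b; case: ifP => // _; exact: absq_ge0.
  apply: hsum_lin; first exact: parseval.
  by apply: hsum_supp => i /negPf iF; rewrite /b iF.
have [z zg _] := riesz_fischer g1 (al (fun i => absq_ge0 _)).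
exists z; apply: (onb_ext g2) => i.
rewrite ipBl !(@sub_proj_adjoint _ _ P Q) Ag linearZ/= -[P _ - Q _]/((P \- Q) _) Ag.
rewrite !ipZr !conj_Creal ?complex_real// zg.
rewrite mulrA -rmorphM/= -expr2 -[X in X - _]mul1r -mulrBl /a mulrA.
have [i1|i1] := eqVneq (mu i ^+ 2) 1; first by rewrite y0// mulr0.
rewrite -[X in X - _]/((1 : R)%:C) -rmorphB -rmorphM/= mulfV ?mul1r//.
by rewrite subr_eq0 eq_sym.
Qed.

Lemma compression_rangeP (y : prange Q) : range (compression Q P) y <->
  forall i, mu i = -1 -> <| val y, g i |> = 0.
Proof.
split=> [[x _ <-] i /eigenN1_proj[Qg Pg] /=|y0].
  by rewrite proj_selfadjoint Qg proj_selfadjoint Pg ip0r.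
have [i /eqP|z zy] := @solve_one_sub_sq (val y).
  rewrite -(expr1n _ 2) eqf_sqr => /orP[] /eqP; last exact: y0.
  by move=> /eigen1_proj[_ Qg]; rewrite -prangeE proj_selfadjoint Qg ip0r.
have PQz : P (Q z) \in prange_pred P by apply: mem_prange; rewrite proj_idem.
exists (PRange PQz) => //; apply: val_inj => /=.
(* Since Q y = y and Q (1 - A^2) = Q P Q, the vector [y] equals Q P (P Q z). *)
rewrite -[RHS]prangeE -zy /= !linearB/= !proj_idem; vec.
Qed.

Let mu_eigen_fset c (i : eigen_fset c) : `|c| = 1 -> mu (val i) = c.
Proof. by move=> c1; apply/eqP; rewrite -eigen_fsetP//; exact: fsvalP. Qed.

Lemma ker_quotient_basis : exists b : 'I_#|` eigen_fset 1| -> prange P,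
  quotient_basis (compression Q P @^-1` [set 0]) [set 0] b.
Proof.
have gP (i : eigen_fset 1) : g (val i) \in prange_pred P.
  exact/mem_prange/(eigen1_proj (mu_eigen_fset i (normr1 _))).1.
rewrite cardfE; eexists.
apply: (@orthonormal_quotient_basis _ _ _ _ _ (fun i => PRange (gP i))).
- by move=> i j; rewrite -val_eqE; exact: g1.
- move=> i; apply: val_inj => /=.
  by have [-> ->] := eigen1_proj (mu_eigen_fset i (normr1 _)).
- by move=> a u v u0 v0; rewrite /preimage/= compression_linear u0 v0 scaler0 addr0.
move=> v /(congr1 val) /= Qv; split=> [-> i|v0]; first exact: ip0l.
rewrite prangeE in Qv.
apply/val_inj/g2 => i; have [i1|i1] := eqVneq (mu i) 1.
  have iF : i \in eigen_fset 1 by rewrite eigen_fsetP ?normr1// i1.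
  exact: (v0 [` iF]%fset).
(* Here P v = v and Q v = 0, so A v = v, and only coefficients at the eigenvalue 1 survive. *)
have : (mu i)%:C * <| val v, g i |> = <| val v, g i |>.
  rewrite -[RHS](_ : <| (P \- Q) (val v), g i |> = _); last by rewrite /= prangeE Qv subr0.
  by rewrite sub_proj_adjoint Ag ipZr conj_Creal ?complex_real.
move/eqP; rewrite -[X in _ == X]mul1r -subr_eq0 -mulrBl mulf_eq0 => /orP[|/eqP//].
by rewrite subr_eq0 (inj_eq (@complexI R) _ 1) (negPf i1).
Qed.

Lemma range_quotient_basis : exists b : 'I_#|` eigen_fset (-1)| -> prange Q,
  quotient_basis setT (range (compression Q P)) b.
Proof.
have gQ (i : eigen_fset (-1)) : g (val i) \in prange_pred Q.
  exact/mem_prange/(eigenN1_proj (mu_eigen_fset i (normrN1 _))).1.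
rewrite cardfE; eexists.
apply: (@orthonormal_quotient_basis _ _ _ _ _ (fun i => PRange (gQ i))) => //.
  by move=> i j; rewrite -val_eqE; exact: g1.
move=> v _; rewrite compression_rangeP; split=> v0 i.
  exact/v0/mu_eigen_fset/normrN1.
move=> iN1; have iF : i \in eigen_fset (-1) by rewrite eigen_fsetP ?normrN1// iN1.
exact: (v0 [` iF]%fset).
Qed.

(** The range is cut out by vanishing coefficients, which are continuous by [bessel1]. *)
Lemma closed_range_compression : closed (range (compression Q P)).
Proof.
move=> y yc; apply/compression_rangeP => i iN1; apply/absq_eq0/eqP.
rewrite eq_le absq_ge0 andbT; apply/ler_addgt0Pr => d d0; rewrite add0r.
have [y' [/compression_rangeP y'0 yy']] := yc _ (sqn_nbhs y d0).
apply: le_trans (ltW yy'); rewrite -[<| _, _ |>]subr0 -(y'0 i iN1) -ipBl.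
exact: (bessel1 _ (sqn_on g1 i)).
Qed.

Lemma bounded_compression : bounded_op (compression Q P).
Proof.
exists 1 => x; rewrite mul1r -(@ler_pXn2r _ 2)// ?nnegrE// !norm_sqn lecR.
apply: le_trans (sqn_proj_le Q _) _; exact: sqn_proj_le.
Qed.

Lemma fredholm_compression : fredholm (compression Q P).
Proof.
have [b bE] := ker_quotient_basis; have [b' b'E] := range_quotient_basis.
split; [exact: bounded_compression|exact: closed_range_compression| |].
- by exists _, b.
- by exists _, b'.
Qed.

Lemma fredholm_index_compression : fredholm_index (compression Q P) =
  #|` eigen_fset 1|%:Z - #|` eigen_fset (-1)|%:Z.
Proof.
have [b bE] := ker_quotient_basis; have [b' b'E] := range_quotient_basis.
rewrite /fredholm_index (quotient_dimE _ _ bE)//; last first.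
  by move=> a u v /= -> ->; rewrite scaler0 addr0.
rewrite (quotient_dimE _ _ b'E)//; first by exists 0 => //; rewrite linear0.
by move=> a u v [x _ <-] [y _ <-]; exists (a *: x + y) => //; rewrite linearP.
Qed.

End FredholmPair.

(** The trace class claim ensures that [trace], which has a default value, is meaningful in the
    index formula. *)
Theorem theorem2p3 (R : realType) (H : hilbertType R) (k : nat)
    (P Q : projection H) (hPQ : schatten (2 * k + 1) (P \- Q)) :
  [/\ fredholm (compression Q P),
      trace_class (op_pow (P \- Q) (2 * k + 1))
    & (fredholm_index (compression Q P))%:~R = trace (op_pow (P \- Q) (2 * k + 1))].
Proof.
have [I [g [mu [g_onb Ag]]]] := spectral_theorem (@sub_proj_adjoint _ _ P Q)
  (@sub_proj_contraction _ _ P Q) hPQ.1.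
have kE : (2 * k + 1)%N = (2 * k).+1 by rewrite addn1.
rewrite kE in hPQ *; split.
- exact: fredholm_compression g_onb Ag hPQ.
- by apply: schatten_pow hPQ; [exact: sub_proj_contraction|exact: sub_proj_adjoint].
rewrite (fredholm_index_compression g_onb Ag hPQ) (trace_odd_pow g_onb Ag hPQ).
  by rewrite rmorphB.
by rewrite /= oddM.
Qed.
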